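(* Define $s(n)$ by $$\sum_{n=0}^{\infty}s(n)q^n=\sum_{n=0}^{\infty}\frac{(-1;q^2)_nq^{n(n+1)}}{(q;q)_{2n}}=\frac{(-q^2;q^2)_\infty}{(q^2;q^2)_\infty}(q^6,-q^3,-q^3;q^6)_\infty.$$ Then for all integers $n\ge0$: $$s(24n+i)\equiv0\pmod4\ \ (i=9,15,21),\qquad s(24n+23)\equiv0\pmod8,\qquad s(24n+17)\equiv0\pmod8,\qquad s(12n+1)\equiv0\pmod{16}.$$
   Context: $(A;q)_0=1$, $(A;q)_n=\prod_{j=0}^{n-1}(1-Aq^j)$, $(A;q)_\infty=\prod_{j\ge0}(1-Aq^j)$, and $(A_1,\dots,A_r;q)_\infty=\prod_i(A_i;q)_\infty$. *)

(* Defs.v *)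
From mathcomp Require Import all_boot all_order all_algebra.
Set Implicit Arguments. Unset Strict Implicit. Unset Printing Implicit Defensive.
Import GRing.Theory Num.Theory.
Local Open Scope ring_scope.

(* Formal power series in q with integer coefficients are handled through
   polynomial truncations: the coefficient of q^n of a power series only
   depends on its truncation modulo q^(n+1).

   geom_trunc j N = 1 + q^j + q^(2j) + ... + q^(Nj), a truncation of 1/(1-q^j)
   that is exact modulo q^(N+1) for j >= 1. *)
Definition geom_trunc (j N : nat) : {poly int} :=
  \sum_(m < N.+1) 'X^(j * m).

Definition poch_m1_q2 (k : nat) : {poly int} :=
  \prod_(i < k) (1 + 'X^(2 * i)).

(* Truncation (exact modulo q^(N+1)) of 1/(q;q)_(2k) = prod_{j=1}^{2k} 1/(1-q^j). *)
Definition inv_poch_q_trunc (k N : nat) : {poly int} :=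
  \prod_(j < 2 * k) geom_trunc j.+1 N.

(* s(n) = coefficient of q^n in
     sum_{k>=0} (-1;q^2)_k q^(k(k+1)) / (q;q)_(2k).
   Terms with k > n have q-valuation k(k+1) > n, so they do not contribute;
   the sum over k <= n with truncated inverses computes the coefficient exactly. *)
Definition s (n : nat) : int :=
  (\sum_(k < n.+1) poch_m1_q2 k * 'X^(k * k.+1) * inv_poch_q_trunc k n)`_n.

(* Main.v *)
(* With phi(q) = 1 + 2 sum_{r>=1} q^(r^2), the series of s equals
   phi(q^3) / phi(-q^2).  This comes from Bailey's lemma in base Q = q^2 with
   parameters (-1, infinity): applied to Slater's pair F(1), whose beta_n is
   1/(q;q)_{2n}, it gives phi(q^3) (-Q;Q)_oo / (Q;Q)_oo, and applied to the
   unit Bailey pair it gives phi(-Q) (-Q;Q)_oo / (Q;Q)_oo = 1.  Both hold in a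
   commutative ring in which q is nilpotent, here Z[q]/(q^(N+1)), where the
   limit in Bailey's lemma is attained exactly.
   Writing phi(q^3) = 1 + 2A and phi(-q^2) = 1 + 2B, the quotient is
   (1 + 2A)(1 - 2B + 4B^2 - 8B^3) mod 16.  As B is even, the coefficient at an
   odd exponent only involves 2A - 4AB + 8AB^2, where B^2 is congruent mod 2 to
   the sum of the q^(4r^2).  Residues mod 24 and 12 show that the exponents in
   question are not of the forms 3x^2, 3x^2 + 2y^2, 3x^2 + 4y^2, as needed. *)
Require Import Defs.
From mathcomp Require Import all_boot all_order all_algebra.
From mathcomp Require Import qpoly ring zify.
Set Implicit Arguments. Unset Strict Implicit. Unset Printing Implicit Defensive.
Import GRing.Theory.
Local Open Scope ring_scope.

(** * Finite Bailey lemma with parameters (-1, infinity), free of division *)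

Section Bailey.

(* [v n] plays the role of 1/(Q;Q)_n; with this recurrence and regularity in
   place of inverses, the results hold over any commutative ring. *)
Variables (R : comNzRingType) (Q : R) (v : nat -> R).
Hypothesis v0 : v 0 = 1.
Hypothesis vS : forall n, v n = (1 - Q ^+ n.+1) * v n.+1.
Hypothesis regQ : forall n, GRing.lreg (1 - Q ^+ n.+1).

Definition poch (b : R) (n : nat) : R := \prod_(i < n) (1 - b * Q ^+ i).

Lemma pochS b n : poch b n.+1 = poch b n * (1 - b * Q ^+ n).
Proof. by rewrite /poch big_ord_recr. Qed.

Lemma pochSl b n : poch b n.+1 = (1 - b) * poch (b * Q) n.
Proof.
rewrite /poch big_ord_recl expr0 mulr1; congr (_ * _).
by apply: eq_bigr => i _; rewrite exprS mulrA.
Qed.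

Lemma poch_add b m n : poch b (m + n) = poch b m * poch (b * Q ^+ m) n.
Proof.
elim: n => [|n IHn]; first by rewrite addn0 {3}/poch big_ord0 mulr1.
by rewrite addnS !pochS IHn exprD !mulrA.
Qed.

Lemma v_add m n : v m = poch (Q ^+ m.+1) n * v (m + n).
Proof.
elim: n => [|n IHn]; first by rewrite addn0 /poch big_ord0 mul1r.
by rewrite IHn (vS (m + n)) pochS addnS -exprD -addSn mulrA.
Qed.

(** The right-hand side does not involve [b], so the induction keeps [b] general. Pascal's rule
    reduces [m.+1] to [m] at [b] and at [b * Q]; the two coefficients add up to [1 - d * Q ^+ m]. *)
Lemma q_chu_vandermonde m b d :
  \sum_(j < m.+1) v j * v (m - j) * poch b j * (- d) ^+ j * Q ^+ 'C(j, 2)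
     * poch (b * d * Q ^+ j) (m - j) = poch d m * v m.
Proof.
elim: m b => [|m IHm] b; first by rewrite big_ord1 /poch !big_ord0 v0 !expr0 !mulr1.
apply: (@regQ m).
pose F b m (j : nat) := v j * v (m - j) * poch b j * (- d) ^+ j * Q ^+ 'C(j, 2)
     * poch (b * d * Q ^+ j) (m - j).
(* Pascal's rule: 1 - Q^(m+1) = (1 - Q^(m+1-j)) + Q^(m+1-j) (1 - Q^j). *)
rewrite mulr_sumr.
transitivity (\sum_(j < m.+2) (1 - Q ^+ (m.+1 - j)) * F b m.+1 j
   + \sum_(j < m.+2) Q ^+ (m.+1 - j) * (1 - Q ^+ j) * F b m.+1 j).
  rewrite -big_split /=; apply: eq_bigr => j _.
  have -> : Q ^+ m.+1 = Q ^+ (m.+1 - j) * Q ^+ j.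
    by rewrite -exprD subnK // -ltnS.
  rewrite /F; ring.
rewrite big_ord_recr /= subnn expr0 subrr mul0r addr0.
rewrite [X in _ + X]big_ord_recl /= expr0 subrr mulr0 mul0r add0r.
transitivity ((1 - b * d * Q ^+ m) * (\sum_(j < m.+1) F b m j)
   - Q ^+ m * d * (1 - b) * (\sum_(j < m.+1) F (b * Q) m j)).
  rewrite !mulr_sumr -sumrN; congr (_ + _); apply: eq_bigr => -[j /= ltj] _.
    rewrite /F subSn // pochS [v (m - j)]vS.
    have -> : Q ^+ m = Q ^+ j * Q ^+ (m - j) by rewrite -exprD subnKC.
    ring.
  rewrite /bump /= add1n subSS /F subSS pochSl binS bin1 [v j]vS.
  have -> : Q ^+ m = Q ^+ j * Q ^+ (m - j) by rewrite -exprD subnKC.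
  have -> : b * Q * d * Q ^+ j = b * d * Q ^+ j.+1 by rewrite exprS; ring.
  rewrite exprD [(- d) ^+ _.+1]exprS; ring.
rewrite !IHm pochS [v m]vS; ring.
Qed.

(** This is q-Chu-Vandermonde at b = -Q^r, d = -Q^(r+1): then b d Q^j = Q^(2r+j+1), and the last
    Pochhammer factor turns v(2r+m) into v(2r+j). *)
Lemma conjugate_bailey_sum r m :
  \sum_(j < m.+1) poch (-1) (r + j) * Q ^+ 'C((r + j).+1, 2)
     * (v (m - j) * v j * v (r + j + r))
  = poch (-1) r * Q ^+ 'C(r.+1, 2) * poch (- Q ^+ r.+1) m
     * (v m * v (r + m + r)).
Proof.
transitivity (poch (-1) r * Q ^+ 'C(r.+1, 2) * v (r + m + r)
   * (poch (- Q ^+ r.+1) m * v m)); last by ring.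
rewrite -(q_chu_vandermonde m (- Q ^+ r)) mulr_sumr.
apply: eq_bigr => -[j /= ltj] _.
rewrite poch_add [v (r + j + r)](v_add _ (m - j)) mulN1r.
have -> : (r + j + r + (m - j) = r + m + r)%N by lia.
have -> : - Q ^+ r * - Q ^+ r.+1 * Q ^+ j = Q ^+ (r + j + r).+1.
  by rewrite mulrNN -!exprD; congr (_ ^+ _); lia.
have -> : Q ^+ 'C((r + j).+1, 2) = Q ^+ 'C(r.+1, 2) * (Q ^+ r.+1) ^+ j * Q ^+ 'C(j, 2).
  rewrite -exprM -!exprD; congr (_ ^+ _).
  elim: j {ltj} => [|j IHj]; first by rewrite muln0 !addn0.
  by rewrite addnS binS bin1 IHj (binS j) bin1; lia.
rewrite opprK; ring.
Qed.

Lemma triangular_exchange (F : nat -> nat -> R) n :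
  \sum_(k < n.+1) \sum_(r < k.+1) F k r
  = \sum_(r < n.+1) \sum_(j < (n - r).+1) F (r + j)%N r.
Proof.
elim: n => [|n IHn]; first by rewrite !big_ord1.
rewrite big_ord_recr /= IHn [RHS]big_ord_recr /= subnn big_ord1 addn0.
rewrite [X in _ + X]big_ord_recr /= addrA -big_split; congr (_ + _).
apply: eq_bigr => -[r /= ltr] _.
by rewrite subSn // [RHS]big_ord_recr /= -subSn // subnKC // ltnW.
Qed.

(* The number of integers of absolute value r, so that [one_two]-weighted sums
   over naturals are bilateral sums. *)
Definition one_two (r : nat) : R := if r is 0 then 1 else 2.

Definition one_plus_Q (r : nat) : R := if r is 0 then 1 else 1 + Q ^+ r.

(* The pair is (alpha', beta) with alpha'_r = one_plus_Q r * alpha_r; the factor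
   1 + Q^r cancels (-1)_r / (-Q)_r = 2 / (1 + Q^r). *)
Lemma bailey_lemma (alpha beta : nat -> R) n :
  (forall k, \sum_(r < k.+1) one_plus_Q r * alpha r
               * (v (k - r) * v (k + r)) = beta k) ->
  \sum_(k < n.+1) poch (-1) k * Q ^+ 'C(k.+1, 2) * v (n - k) * beta k
  = poch (- Q) n * \sum_(r < n.+1) one_two r * alpha r
      * Q ^+ 'C(r.+1, 2) * (v (n - r) * v (n + r)).
Proof.
move=> ab.
under eq_bigr => k _ do rewrite -ab mulr_sumr.
rewrite (triangular_exchange (fun k r => poch (-1) k * Q ^+ 'C(k.+1, 2) * v (n - k)
  * (one_plus_Q r * alpha r * (v (k - r) * v (k + r))))).
rewrite mulr_sumr; apply: eq_bigr => -[r /= ltr] _.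
transitivity (one_plus_Q r * alpha r
  * \sum_(j < (n - r).+1) poch (-1) (r + j) * Q ^+ 'C((r + j).+1, 2)
     * (v (n - r - j) * v j * v (r + j + r))).
  rewrite mulr_sumr; apply: eq_bigr => j _.
  rewrite subnDA addKn; ring.
rewrite conjugate_bailey_sum.
have -> : (r + (n - r) + r = n + r)%N by lia.
suff E : one_plus_Q r * poch (-1) r * poch (- Q ^+ r.+1) (n - r)
   = one_two r * poch (- Q) n.
  transitivity (one_plus_Q r * poch (-1) r
    * poch (- Q ^+ r.+1) (n - r) * (alpha r * Q ^+ 'C(r.+1, 2) * (v (n - r) * v (n + r)))).
    ring.
  rewrite E; ring.
case: r ltr => [|r] ltr /=; first by rewrite subn0 /poch big_ord0 !mul1r.
have -> : poch (- Q) n = poch (- Q) (r.+1 + (n - r.+1)) by rewrite subnKC.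
rewrite poch_add pochSl pochS mulN1r mulNr -exprS mulNr -exprS; ring.
Qed.

(** A closed form for all partial sums makes a term-by-term induction possible; at m = n the factor
    1 - Q^(n-m) makes the full sum vanish. *)
Lemma unit_bailey_pair_partial n m : (m <= n)%N ->
  (1 - Q ^+ n) * \sum_(r < m.+1) one_plus_Q r
     * ((-1) ^+ r * Q ^+ 'C(r, 2)) * (v (n - r) * v (n + r))
  = (-1) ^+ m * Q ^+ 'C(m.+1, 2) * (1 - Q ^+ (n - m)) * (v (n - m) * v (n + m)).
Proof.
elim: m => [|m IHm] lemn.
  by rewrite big_ord1 /= subn0 addn0 !expr0; ring.
rewrite big_ord_recr /= mulrDr IHm; last exact: ltnW.
have [l ->] : exists l, n = (m.+1 + l)%N by exists (n - m.+1)%N; rewrite subnKC.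
have -> : (m.+1 + l - m = l.+1)%N by lia.
have -> : (m.+1 + l + m = m + m + l.+1)%N by lia.
have -> : (m.+1 + l + m.+1 = (m + m + l.+1).+1)%N by lia.
rewrite addKn [v l]vS [v (m + m + l.+1)]vS !(binS _ 1) !bin1 /=.
rewrite !(exprS, exprD); ring.
Qed.

Lemma unit_bailey_pair n :
  \sum_(r < n.+1) one_plus_Q r
     * ((-1) ^+ r * Q ^+ 'C(r, 2)) * (v (n - r) * v (n + r)) = (n == 0)%:R.
Proof.
case: n => [|n]; first by rewrite big_ord1 /= v0 !expr0 !mulr1.
apply: (@regQ n).
by rewrite unit_bailey_pair_partial // subnn expr0 subrr mulr0 mul0r mulr0.
Qed.

End Bailey.

(** * Slater's pair F(1) and the theta quotient for nilpotent q *)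

Section SlaterIdentity.

(* [w n] plays the role of 1/(q;q^2)_n, so that [v n * w n] is 1/(q;q)_{2n}. *)
Variables (R : comNzRingType) (q : R) (v w : nat -> R).
Let Q := q ^+ 2.
Hypothesis v0 : v 0 = 1.
Hypothesis w0 : w 0 = 1.
Hypothesis vS : forall n, v n = (1 - Q ^+ n.+1) * v n.+1.
Hypothesis wS : forall n, w n = (1 - q ^+ (2 * n).+1) * w n.+1.
Hypothesis reg_q : forall n, GRing.lreg (1 - q ^+ n.+1).

Lemma reg_q2 n : GRing.lreg (1 - Q ^+ n.+1).
Proof. by rewrite /Q -exprM mulnS; apply: reg_q. Qed.

(* The last term is a Wilf-Zeilberger certificate for the sum over r. *)
Lemma slater_F1_partial n m : (m <= n)%N ->
  (1 - q ^+ (2 * n).+1) * (1 - q ^+ (2 * n).+2) *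
   \sum_(r < m.+1) one_plus_Q Q r * q ^+ (r * (2 * r).-1)
     * (v (n.+1 - r) * v (n.+1 + r))
  = \sum_(r < m.+1) one_plus_Q Q r * q ^+ (r * (2 * r).-1)
     * (v (n - r) * v (n + r))
   + q ^+ (2 * n).+1 * (q ^+ (m.+1 * (2 * m).+1) - q ^+ (m * (2 * m).+1))
     * (v (n - m) * v (n + m).+1).
Proof.
elim: m => [|m IHm] lemn.
  rewrite !big_ord1 /= !subn0 !addn0 !mul0n mul1n muln0 expr0 expr1 [v n]vS.
  rewrite /Q -exprM mulnS !exprS; ring.
rewrite big_ord_recr [in RHS]big_ord_recr /= mulrDr IHm; last exact: ltnW.
have [l ->] : exists l, n = (m.+1 + l)%N by exists (n - m.+1)%N; rewrite subnKC.
have -> : (m.+1 + l - m = l.+1)%N by lia.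
have -> : ((m.+1 + l).+1 - m.+1 = l.+1)%N by lia.
have -> : ((m.+1 + l).+1 + m.+1 = (m + m + l).+3)%N by lia.
have -> : (m.+1 + l + m.+1 = (m + m + l).+2)%N by lia.
have -> : ((m.+1 + l + m).+1 = (m + m + l).+2)%N by lia.
rewrite addKn [v l]vS [v (m + m + l).+2]vS.
(* Every power of q becomes a monomial in [W], [q ^+ m], [q ^+ l] and q, which leaves a polynomial
   identity. *)
set W := q ^+ (m * (2 * m).+1).
have -> : q ^+ (m.+1 * (2 * m.+1).-1) = W * (q ^+ m) ^+ 2 * q.
  by rewrite -exprM -exprD -exprSr; congr (_ ^+ _); lia.
have -> : q ^+ (m.+1 * (2 * m).+1) = W * (q ^+ m) ^+ 2 * q.
  by rewrite -exprM -exprD -exprSr; congr (_ ^+ _); lia.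
have -> : q ^+ (m.+2 * (2 * m.+1).+1) = W * (q ^+ m) ^+ 6 * q ^+ 6.
  by rewrite -exprM -!exprD; congr (_ ^+ _); lia.
have -> : q ^+ (m.+1 * (2 * m.+1).+1) = W * (q ^+ m) ^+ 4 * q ^+ 3.
  by rewrite -exprM -!exprD; congr (_ ^+ _); lia.
have -> : q ^+ (2 * (m.+1 + l)).+2 = q ^+ 4 * (q ^+ m) ^+ 2 * (q ^+ l) ^+ 2.
  by rewrite -!exprM -!exprD; congr (_ ^+ _); lia.
have -> : q ^+ (2 * (m.+1 + l)).+1 = q ^+ 3 * (q ^+ m) ^+ 2 * (q ^+ l) ^+ 2.
  by rewrite -!exprM -!exprD; congr (_ ^+ _); lia.
have -> : Q ^+ l.+1 = q ^+ 2 * (q ^+ l) ^+ 2.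
  by rewrite -!exprM -!exprD; congr (_ ^+ _); lia.
have -> : Q ^+ m.+1 = q ^+ 2 * (q ^+ m) ^+ 2.
  by rewrite -!exprM -!exprD; congr (_ ^+ _); lia.
have -> : Q ^+ (m + m + l).+3 = q ^+ 6 * (q ^+ m) ^+ 4 * (q ^+ l) ^+ 2.
  by rewrite -!exprM -!exprD; congr (_ ^+ _); lia.
ring.
Qed.

(** Both sides satisfy the same first-order recurrence in n: the certificate at m = n cancels the
    new term r = n+1. *)
Lemma slater_F1 n :
  \sum_(r < n.+1) one_plus_Q Q r * q ^+ (r * (2 * r).-1)
     * (v (n - r) * v (n + r)) = v n * w n.
Proof.
elim: n => [|n IHn]; first by rewrite big_ord1 /= v0 w0 !mulr1.
apply: (@reg_q (2 * n)); apply: (@reg_q (2 * n).+1).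
transitivity ((1 - q ^+ (2 * n).+1) * (1 - q ^+ (2 * n).+2) *
   \sum_(r < n.+2) one_plus_Q Q r * q ^+ (r * (2 * r).-1)
     * (v (n.+1 - r) * v (n.+1 + r))); first by ring.
rewrite big_ord_recr mulrDr slater_F1_partial // IHn /= !subnn.
have -> : (n.+1 + n.+1 = (n + n).+2)%N by lia.
rewrite [v n]vS [w n]wS v0 [v (n + n).+1]vS.
have -> : Q ^+ (n + n).+2 = (q ^+ n) ^+ 4 * q ^+ 4.
  by rewrite -!exprM -exprD; congr (_ ^+ _); lia.
have -> : Q ^+ n.+1 = (q ^+ n) ^+ 2 * q ^+ 2.
  by rewrite -!exprM -exprD; congr (_ ^+ _); lia.
have -> : q ^+ (n.+1 * (2 * n.+1).-1) = q ^+ (n * (2 * n).+1) * (q ^+ n) ^+ 2 * q.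
  by rewrite -exprM -exprD -exprSr; congr (_ ^+ _); lia.
have -> : q ^+ (n.+1 * (2 * n).+1) = q ^+ (n * (2 * n).+1) * (q ^+ n) ^+ 2 * q.
  by rewrite -exprM -exprD -exprSr; congr (_ ^+ _); lia.
have -> : q ^+ (2 * n).+2 = q ^+ 2 * (q ^+ n) ^+ 2.
  by rewrite -exprM -exprD; congr (_ ^+ _); lia.
have -> : q ^+ (2 * n).+1 = q * (q ^+ n) ^+ 2.
  by rewrite -exprM -exprS; congr (_ ^+ _); lia.
ring.
Qed.

Lemma expr_bin2 n : Q ^+ 'C(n, 2) = q ^+ (n * n.-1).
Proof.
rewrite /Q -exprM; congr (_ ^+ _).
by elim: n => // n IHn; rewrite binS bin1 mulnDr IHn; case: (n) => // k; nia.
Qed.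

Variable N : nat.
Hypothesis q_nilp : q ^+ N.+1 = 0.

Lemma expr_nilp k : (N < k)%N -> q ^+ k = 0.
Proof. by move=> ltNk; rewrite -(subnKC ltNk) exprD q_nilp mul0r. Qed.

(** Raising the index of [v] beyond m only adds multiples of q^(2m+2), which q^e annihilates. This
    replaces the limit n -> infinity. *)
Lemma expr_v_stable e m l : (N < e + 2 * m.+1)%N -> q ^+ e * v (m + l) = q ^+ e * v m.
Proof.
move=> lt_e; elim: l => [|l IHl]; first by rewrite addn0.
rewrite -IHl [v (m + l)]vS addnS mulrBl mul1r mulrBr mulrA /Q -exprM -exprD.
by rewrite (@expr_nilp (e + _)) ?mul0r ?subr0 //; lia.
Qed.

Lemma v_inv n : v n * poch Q Q n = 1.
Proof.
have := v_add vS 0 n; rewrite add0n expr1 v0 => ->.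
by rewrite mulrC.
Qed.

(** Bailey's lemma at n = N, with each [v (N - k)], [v (N - r)] and [v (N + r)] replaced by [v N].
    The factor q^(r(r-1)), common to the unit pair and F(1), is split off [alpha]; with q^(r(r+1))
    it gives q^(2r^2). *)
Lemma bailey_limit (alpha beta : nat -> R) :
  (forall k, \sum_(r < k.+1) one_plus_Q Q r * q ^+ (r * r.-1) * alpha r
               * (v (k - r) * v (k + r)) = beta k) ->
  \sum_(k < N.+1) poch Q (-1) k * q ^+ (k * k.+1) * beta k
  = poch Q (- Q) N * v N * \sum_(r < N.+1) one_two R r * q ^+ (2 * r ^ 2) * alpha r.
Proof.
move=> ab.
have : \sum_(k < N.+1) poch Q (-1) k * Q ^+ 'C(k.+1, 2) * v (N - k) * beta k
  = v N * \sum_(k < N.+1) poch Q (-1) k * q ^+ (k * k.+1) * beta k.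
  rewrite mulr_sumr; apply: eq_bigr => -[k /= ltk] _.
  rewrite expr_bin2 mulnC /=.
  transitivity (poch Q (-1) k * beta k * (q ^+ (k * k.+1) * v (N - k))); first by ring.
  rewrite -(expr_v_stable k); last by nia.
  rewrite subnK //; ring.
rewrite (bailey_lemma v0 vS reg_q2 N (alpha := fun r => q ^+ (r * r.-1) * alpha r)); last first.
  by move=> k; rewrite -ab; apply: eq_bigr => r _; rewrite !mulrA.
(* The sum over k carries a factor [v N], whose inverse is [poch Q Q N]. *)
move/(congr1 (fun x => poch Q Q N * x)); rewrite [RHS]mulrA [_ * v N]mulrC v_inv mul1r => <-.
rewrite !mulr_sumr; apply: eq_bigr => -[r /= ltr] _.
rewrite expr_bin2 [(r.+1 * _)%N]mulnC /=.
have stable : q ^+ (2 * r ^ 2) * v (N - r) = q ^+ (2 * r ^ 2) * v N.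
  by rewrite -(expr_v_stable r) ?subnK //; nia.
have -> : v (N + r) = v N.
  by have := @expr_v_stable 0 N r; rewrite expr0 !mul1r => -> //; lia.
move: stable.
have -> : q ^+ (2 * r ^ 2) = q ^+ (r * r.-1) * q ^+ (r * r.+1).
  by rewrite -exprD; congr (_ ^+ _); case: (r) => [|r']; lia.
move=> stable.
transitivity (poch Q Q N * poch Q (- Q) N * v N * one_two R r * alpha r *
  (q ^+ (r * r.-1) * q ^+ (r * r.+1) * v (N - r))); first by ring.
rewrite stable.
transitivity ((v N * poch Q Q N) * (poch Q (- Q) N * v N * one_two R r * alpha r *
  (q ^+ (r * r.-1) * q ^+ (r * r.+1)))); first by ring.
rewrite v_inv; ring.
Qed.

(** Gauss's product for phi(-Q): the beta of the unit Bailey pair kills every term but k = 0. *)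
Lemma gauss_theta :
  poch Q (- Q) N * v N * \sum_(r < N.+1) one_two R r * ((-1) ^+ r * q ^+ (2 * r ^ 2)) = 1.
Proof.
transitivity (poch Q (- Q) N * v N *
   \sum_(r < N.+1) one_two R r * q ^+ (2 * r ^ 2) * (-1) ^+ r).
  by congr (_ * _); apply: eq_bigr => r _; ring.
rewrite -(@bailey_limit _ (fun k => (k == 0)%:R)).
  rewrite big_ord_recl big1 => [|i _]; last by rewrite mulr0.
  by rewrite /poch big_ord0 /= mul0n expr0 !mulr1 addr0.
move=> k; rewrite -(unit_bailey_pair v0 vS reg_q2); apply: eq_bigr => r _.
rewrite expr_bin2; ring.
Qed.

(** F(1) has exponent r(2r-1) = r(r-1) + r^2, so its alpha here is q^(r^2). The product in
    [bailey_limit] then cancels by [gauss_theta]. *)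
Lemma slater_mod6 :
  (\sum_(k < N.+1) poch Q (-1) k * q ^+ (k * k.+1) * (v k * w k))
   * \sum_(r < N.+1) one_two R r * ((-1) ^+ r * q ^+ (2 * r ^ 2))
  = \sum_(r < N.+1) one_two R r * q ^+ (3 * r ^ 2).
Proof.
rewrite (@bailey_limit (fun r => q ^+ (r ^ 2)) (fun k => v k * w k)); last first.
  move=> k; rewrite -slater_F1; apply: eq_bigr => r _.
  rewrite -[one_plus_Q _ _ * _ * _]mulrA -exprD; congr (_ * _ ^+ _ * _).
  by case: (r : nat) => // r'; nia.
rewrite mulrAC gauss_theta mul1r.
by apply: eq_bigr => r _; rewrite -mulrA -exprD; congr (_ * _ ^+ _); lia.
Qed.

End SlaterIdentity.

(** * Expansion of a theta quotient modulo 16 *)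

Lemma sqr_sum (R : comNzRingType) n (x : 'I_n -> R) :
  exists y, (\sum_(i < n) x i) ^+ 2 = \sum_(i < n) x i ^+ 2 + y *+ 2.
Proof.
elim: n x => [|n IHn] x; first by (exists 0; rewrite !big_ord0 expr0n mul0rn addr0).
have [y eq_y] := IHn (fun i => x (widen_ord (leqnSn n) i)).
exists (y + (\sum_(i < n) x (widen_ord (leqnSn n) i)) * x ord_max).
rewrite !big_ord_recr /= sqrrD eq_y; ring.
Qed.

(** Rests on (1 + 2b)(1 - 2b + 4b^2 - 8b^3) = 1 - 16b^4. The free [y] allows b^2 to be replaced by
    anything congruent to it mod 2. Stating the result as an image under [f] keeps the multiple of
    16 explicit in [S]. *)
Lemma theta_quotient_mod16 (S R : comNzRingType) (f : {rmorphism S -> R}) (p a b y : S) :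
  f p * (1 + f b *+ 2) = 1 + f a *+ 2 ->
  f p = f (1 - b *+ 2 + b ^+ 2 *+ 4 - b ^+ 3 *+ 8 + a *+ 2 - (a * b) *+ 4
    + (a * (b ^+ 2 - y *+ 2)) *+ 8 + (a * y - a * b ^+ 3 + b ^+ 4 * p) *+ 16).
Proof.
rewrite !(rmorphD, rmorphN, rmorphM, rmorphMn, rmorphXn, rmorph1) /=.
move: (f p) (f a) (f b) (f y) => {}p {}a {}b {}y eq_p.
transitivity (p * (1 + b *+ 2) * (1 - b *+ 2 + b ^+ 2 *+ 4 - b ^+ 3 *+ 8) + b ^+ 4 * p *+ 16).
  ring.
rewrite eq_p; ring.
Qed.

(** * Transfer to polynomials modulo q^(N+1) and extraction of coefficients *)

Section Truncation.

Variable N : nat.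

Let trunc : {rmorphism {poly int} -> {poly %/ ('X^(N.+1) : {poly int})}} :=
  @in_qpoly int 'X^(N.+1).

Lemma trunc_Xn : trunc 'X ^+ N.+1 = 0.
Proof.
rewrite -rmorphXn; apply/val_inj => /=.
by rewrite mk_monic_Xn Pdiv.RingMonic.rmodpp // monicXn.
Qed.

Lemma trunc_coef (p r : {poly int}) i : trunc p = trunc r -> (i <= N)%N -> p`_i = r`_i.
Proof.
move=> /(congr1 val) /=; rewrite mk_monic_Xn /= => eq_mod leiN.
have monX : 'X^(N.+1) \is @monic int by exact: monicXn.
rewrite (Pdiv.RingMonic.rdivp_eq monX p) (Pdiv.RingMonic.rdivp_eq monX r).
by rewrite eq_mod !coefD !coefMXn ltnS leiN.
Qed.

Lemma trunc_geom j : (1 - trunc 'X ^+ j.+1) * trunc (geom_trunc j.+1 N) = 1.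
Proof.
have -> : trunc (geom_trunc j.+1 N) = \sum_(m < N.+1) (trunc 'X ^+ j.+1) ^+ m.
  by rewrite /geom_trunc rmorph_sum; apply: eq_bigr => m _; rewrite rmorphXn exprM.
apply: oppr_inj; rewrite -mulNr opprB -subrX1 -exprM mulnC exprM trunc_Xn.
by rewrite expr0n sub0r.
Qed.

Lemma trunc_reg j : GRing.lreg (1 - trunc 'X ^+ j.+1).
Proof.
move=> a b /(congr1 (fun x => trunc (geom_trunc j.+1 N) * x)).
by rewrite !mulrA [_ * (1 - _)]mulrC trunc_geom !mul1r.
Qed.

Definition s_poly : {poly int} :=
  \sum_(k < N.+1) poch_m1_q2 k * 'X^(k * k.+1) * inv_poch_q_trunc k N.

(** [theta3] and [theta2] are A and B with phi(q^3) = 1 + 2A and phi(-q^2) = 1 + 2B; the omitted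
    terms have exponents above N. *)
Definition theta3 : {poly int} := \sum_(r < N) 'X^(3 * r.+1 ^ 2).

Definition theta2 : {poly int} := \sum_(r < N) (-1) ^+ r.+1 * 'X^(2 * r.+1 ^ 2).

Lemma trunc_s_poly : trunc s_poly * (1 + trunc theta2 *+ 2) = 1 + trunc theta3 *+ 2.
Proof.
pose q := trunc 'X.
(* The factors of 1/(q;q)_(2k) are sorted by parity, even in [v] and odd in [w]; in the quotient
   ring the truncated geometric series are exact inverses. *)
pose v k := \prod_(i < k) trunc (geom_trunc (2 * i).+2 N).
pose w k := \prod_(i < k) trunc (geom_trunc (2 * i).+1 N).
have v0 : v 0 = 1 by rewrite /v big_ord0.
have w0 : w 0 = 1 by rewrite /w big_ord0.
have vS n : v n = (1 - (q ^+ 2) ^+ n.+1) * v n.+1.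
  rewrite /v big_ord_recr /= mulrCA -exprM mulnS trunc_geom; exact/esym/mulr1.
have wS n : w n = (1 - q ^+ (2 * n).+1) * w n.+1.
  rewrite /w big_ord_recr /= mulrCA trunc_geom; exact/esym/mulr1.
have := slater_mod6 v0 w0 vS wS trunc_reg trunc_Xn.
have -> : \sum_(k < N.+1) poch (q ^+ 2) (-1) k * q ^+ (k * k.+1) * (v k * w k) = trunc s_poly.
  rewrite /s_poly rmorph_sum; apply: eq_bigr => k _; rewrite !rmorphM rmorphXn.
  congr (_ * _ * _).
    rewrite /poch_m1_q2 /poch rmorph_prod; apply: eq_bigr => i _.
    by rewrite mulN1r opprK rmorphD rmorph1 rmorphXn exprM.
  rewrite /inv_poch_q_trunc rmorph_prod; elim: (k : nat) => [|{}k IHk].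
    by rewrite muln0 v0 w0 big_ord0 mulr1.
  rewrite mulnS !big_ord_recr /= -IHk /v /w !big_ord_recr /=; ring.
have -> : \sum_(r < N.+1) one_two _ r * ((-1) ^+ r * q ^+ (2 * r ^ 2)) = 1 + trunc theta2 *+ 2.
  rewrite big_ord_recl /= !expr0 !mulr1; congr (_ + _).
  rewrite /theta2 rmorph_sum -sumrMnl; apply: eq_bigr => r _.
  by rewrite rmorphM !rmorphXn rmorphN1 /q /bump /= add1n mulr_natl.
have -> : \sum_(r < N.+1) one_two _ r * q ^+ (3 * r ^ 2) = 1 + trunc theta3 *+ 2.
  rewrite big_ord_recl /= !expr0 !mulr1; congr (_ + _).
  rewrite /theta3 rmorph_sum -sumrMnl; apply: eq_bigr => r _.
  by rewrite rmorphXn /q /bump /= add1n mulr_natl.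
by [].
Qed.

Definition theta4 : {poly int} := \sum_(r < N) 'X^(4 * r.+1 ^ 2).

Lemma theta2_sqr : exists Y, theta2 ^+ 2 = theta4 + Y *+ 2.
Proof.
have [Y ->] := sqr_sum (fun r : 'I_N => (-1) ^+ r.+1 * 'X^(2 * r.+1 ^ 2) : {poly int}).
exists Y; congr (_ + _); apply: eq_bigr => r _.
by rewrite exprMn sqrr_sign mul1r -exprM; congr (_ ^+ _); lia.
Qed.

Lemma coef_theta3 M : (forall x, 3 * x ^ 2 != M)%N -> theta3`_M = 0.
Proof.
move=> neM; rewrite coef_sum big1 // => r _.
by rewrite coefXn eq_sym (negPf (neM _)).
Qed.

Lemma coef_theta32 M : (forall x y, 3 * x ^ 2 + 2 * y ^ 2 != M)%N ->
  (theta3 * theta2)`_M = 0.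
Proof.
move=> neM; rewrite mulr_suml coef_sum big1 // => r _.
rewrite mulr_sumr coef_sum big1 // => t _.
rewrite mulrCA -exprD -signr_odd mulr_sign.
by case: ifP; rewrite ?coefN coefXn eq_sym (negPf (neM _ _)) ?oppr0.
Qed.

Lemma coef_theta34 M : (forall x y, 3 * x ^ 2 + 4 * y ^ 2 != M)%N ->
  (theta3 * theta4)`_M = 0.
Proof.
move=> neM; rewrite mulr_suml coef_sum big1 // => r _.
rewrite mulr_sumr coef_sum big1 // => t _.
by rewrite -exprD coefXn eq_sym (negPf (neM _ _)).
Qed.

(** [theta2] is a polynomial in X^2, hence so are its powers. *)
Lemma coef_theta2_exp_odd k M : odd M -> (theta2 ^+ k)`_M = 0.
Proof.
move=> oddM.
have -> : theta2 = (\sum_(r < N) (-1) ^+ r.+1 * 'X^(r.+1 ^ 2)) \Po 'X^2.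
  rewrite raddf_sum; apply: eq_bigr => r _ /=.
  by rewrite rmorphM !rmorphXn rmorphN1 /= comp_polyX -exprM.
by rewrite -rmorphXn coef_comp_poly_Xn // dvdn2 oddM.
Qed.

Lemma s_mod16 : odd N -> exists z,
  s N = theta3`_N *+ 2 - (theta3 * theta2)`_N *+ 4 + (theta3 * theta4)`_N *+ 8 + z *+ 16.
Proof.
move=> oddN; have [Y sqrY] := theta2_sqr.
set A := theta3; set B := theta2 in sqrY |- *; set C := theta4 in sqrY |- *.
have BN : B`_N = 0 by rewrite -[B]expr1 coef_theta2_exp_odd.
exists (A * Y - A * B ^+ 3 + B ^+ 4 * s_poly)`_N.
rewrite -[LHS]/(s_poly`_N).
rewrite (@trunc_coef _ (1 - B *+ 2 + B ^+ 2 *+ 4 - B ^+ 3 *+ 8 + A *+ 2 - (A * B) *+ 4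
  + (A * C) *+ 8 + (A * Y - A * B ^+ 3 + B ^+ 4 * s_poly) *+ 16)) //.
  rewrite !coefD !coefN !coefMn BN !coef_theta2_exp_odd //.
  (* The constant 1 contributes nothing, since an odd [N] is nonzero. *)
  rewrite coefC; case: (N) oddN => // n _ /=; ring.
have -> : C = B ^+ 2 - Y *+ 2 by rewrite sqrY addrK.
exact/theta_quotient_mod16/trunc_s_poly.
Qed.

End Truncation.

(** * Residue obstructions to representation by the quadratic forms, and the congruences *)

Definition not_rep (a b m c : nat) : bool :=
  all (fun x => all (fun y => (a * x ^ 2 + b * y ^ 2) %% m != c)%N (iota 0 m)) (iota 0 m).

(** Only x and y modulo m matter, so a finite check, settled by computation, covers all naturals. *)
Lemma not_repP a b m c M x y : (0 < m)%N -> not_rep a b m c -> (M %% m)%N = c ->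
  (a * x ^ 2 + b * y ^ 2 != M)%N.
Proof.
move=> m0 /allP nrep eqc; apply/eqP => eqM.
have mem_mod z : (z %% m)%N \in iota 0 m by rewrite mem_iota ltn_mod.
have /allP/(_ _ (mem_mod y))/eqP := nrep _ (mem_mod x); apply.
by rewrite -eqc -eqM -modnDm -[in LHS]modnMmr -[X in (_ + X)%N]modnMmr !modnXm !modnMmr modnDm.
Qed.

Lemma not_repP1 a m c M x : (0 < m)%N -> not_rep a 0 m c -> (M %% m)%N = c ->
  (a * x ^ 2 != M)%N.
Proof. by move=> m0 nrep eqc; have := not_repP x 0 m0 nrep eqc; rewrite addn0. Qed.

Theorem theorem8 :
  forall n : nat,
    (4 %| s (24 * n + 9)%N)%Z /\
    (4 %| s (24 * n + 15)%N)%Z /\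
    (4 %| s (24 * n + 21)%N)%Z /\
    (8 %| s (24 * n + 23)%N)%Z /\
    (8 %| s (24 * n + 17)%N)%Z /\
    (16 %| s (12 * n + 1)%N)%Z.
Proof.
(* In [s_mod16], the vanishing of the [theta3] coefficient gives divisibility by 4, that of
   [theta3 * theta2] also gives 8, and that of [theta3 * theta4] also gives 16. *)
have mod4 M c : (M %% 24)%N = c -> odd M -> not_rep 3 0 24 c -> (4 %| s M)%Z.
  move=> eqc oddM nrep; have [z ->] := s_mod16 oddM.
  rewrite coef_theta3 => [|x]; last exact: not_repP1 nrep eqc.
  lia.
have mod8 M c : (M %% 24)%N = c -> odd M -> not_rep 3 0 24 c -> not_rep 3 2 24 c ->
    (8 %| s M)%Z.
  move=> eqc oddM nrep nrep2; have [z ->] := s_mod16 oddM.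
  rewrite coef_theta3 => [|x]; last exact: not_repP1 nrep eqc.
  rewrite coef_theta32 => [|x y]; last exact: not_repP nrep2 eqc.
  lia.
have mod16 M c : (M %% 12)%N = c -> odd M -> not_rep 3 0 12 c -> not_rep 3 2 12 c ->
    not_rep 3 4 12 c -> (16 %| s M)%Z.
  move=> eqc oddM nrep nrep2 nrep4; have [z ->] := s_mod16 oddM.
  rewrite coef_theta3 => [|x]; last exact: not_repP1 nrep eqc.
  rewrite coef_theta32 => [|x y]; last exact: not_repP nrep2 eqc.
  rewrite coef_theta34 => [|x y]; last exact: not_repP nrep4 eqc.
  lia.
move=> n; do ![split].
- by apply: (mod4 _ 9%N); [lia | lia | vm_compute].
- by apply: (mod4 _ 15%N); [lia | lia | vm_compute].
- by apply: (mod4 _ 21%N); [lia | lia | vm_compute].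
- by apply: (mod8 _ 23%N); [lia | lia | vm_compute | vm_compute].
- by apply: (mod8 _ 17%N); [lia | lia | vm_compute | vm_compute].
- by apply: (mod16 _ 1%N); [lia | lia | vm_compute | vm_compute | vm_compute].
Qed.
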